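(* Let $I,M$ be persistence modules (for $\mathbb{R}$) whose endpoints lie in $L$. Then $$\lim_{X\in\Delta(D)} D^X(\delta^XI,\delta^XM)=D(I,M),$$ where the limit is that of a net indexed by the directed set $\Delta(D)$.
   Context: Fix a field $K$. **Data and the directed set.** Let $D_1,\dots,D_m$ be finite data sets in some metric space. The Vietoris–Rips complex $(C_\epsilon)_{\epsilon>0}$ of a finite data set has as $k$-simplices the sets of $k+1$ data points with pairwise distances $\le\epsilon$; its jump discontinuities are the finitely many $\epsilon>0$ with $C_\epsilon\ne\lim_{\tau\to\epsilon^-}C_\tau$. Let $L\subset\mathbb{R}$ be the (finite) union of the sets of jump discontinuities of the Vietoris–Rips complexes of $D_1,\dots,D_m$. Let $\Delta(D)$ be the set of all finite subsets $X\subset\mathbb{R}$ with $X\supseteq L$, directed by inclusion. **One-dimensional persistence modules.** A persistence module for $\mathbb{R}$ is a functor from the poset $\mathbb{R}$ to finite-dimensional $K$-vector spaces. Those considered here are (isomorphic to) finite direct sums of convex modules $\sigma\sim[r,R)$ with $r<R$ (that is, $\sigma$ is $K$ on $[r,R)$ with identity maps, and $0$ elsewhere). ''Endpoints lie in $L$'' means $r,R\in L$ for every summand. $D(I,M)$ is the classical interleaving distance: the infimum of $\epsilon\ge0$ such that there are morphisms $\phi:I\to M(\cdot+\epsilon)$, $\psi:M\to I(\cdot+\epsilon)$ whose two composites are the structure maps $I\to I(\cdot+2\epsilon)$ and $M\to M(\cdot+2\epsilon)$. For finite $X\subset\mathbb{R}$, $\delta^XI$ is the restriction of the functor $I$ to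 the subposet $X$. **The discrete interleaving metric.** For finite nonempty $X=\{x_1<\dots<x_n\}\subset\mathbb{R}$, $P_X$ is $X$ as a totally ordered set, and $P_X^+=P_X\cup\{\infty\}$ with $p\le\infty$ for all $p$. Fix a weight $b>0$ and put on $P_X^+$ the metric $d(x_i,x_j)=|x_i-x_j|$, $d(x_i,\infty)=x_n-x_i+b$ (the weighted graph metric of the Hasse quiver with weights $x_{i+1}-x_i$ and $b$). An $A(P_X)$-module is a functor from $P_X$ to finite-dimensional $K$-vector spaces, extended to $P_X^+$ by value $0$ at $\infty$. $\mathcal{T}(P_X)$ is the set of order-preserving maps $\Lambda:P_X^+\to P_X^+$ with $\Lambda p\ge p$ for all $p$, with height $h(\Lambda)=\max_p d(p,\Lambda p)$. Put $(M\Lambda)(p)=M(\Lambda p)$, with the obvious maps. A $(\Gamma,\Lambda)$-interleaving between $F$ and $G$ is a pair of morphisms $\phi:F\to G\Lambda$, $\psi:G\to F\Gamma$ such that $(\psi\Lambda)\circ\phi$ has components $F(p\le\Gamma\Lambda p)$ and $(\phi\Gamma)\circ\psi$ has components $G(p\le\Lambda\Gamma p)$, where $(\psi\Lambda)(p)=\psi(\Lambda p)$ and $(\phi\Gamma)(p)=\phi(\Gamma p)$. Then $D^X(F,G)$ is the infimum of $\epsilon$ such that there is a $(\Gamma,\Lambda)$-interleaving with $h(\Gamma),h(\Lambda)\le\epsilon$. *)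

(* Defs.v *)
From HB Require Import structures.
From mathcomp Require Import all_boot all_order all_algebra finmap.
From mathcomp Require Import all_classical all_reals all_analysis.
Import Order.TTheory GRing.Theory Num.Theory.
Import numFieldNormedType.Exports.

Set Implicit Arguments.
Unset Strict Implicit.
Unset Printing Implicit Defensive.

Local Open Scope classical_set_scope.
Local Open Scope ring_scope.

Record pmodule (K : fieldType) d (P : porderType d) := PModule {
  pm_obj :> P -> vectType K;
  pm_map : forall s t : P, (s <= t)%O -> 'Hom(pm_obj s, pm_obj t);
  pm_id : forall (s : P) (h : (s <= s)%O), pm_map h = \1%VF;
  pm_comp : forall (s t u : P) (h1 : (s <= t)%O) (h2 : (t <= u)%O)
    (h3 : (s <= u)%O), pm_map h3 = (pm_map h2 \o pm_map h1)%VF }.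

Record pmorphism (K : fieldType) d (P : porderType d) (F G : pmodule K P) :=
  PMorphism {
    pmor :> forall p : P, 'Hom(F p, G p);
    pmor_nat : forall (s t : P) (h : (s <= t)%O),
      (pm_map G h \o pmor s = pmor t \o pm_map F h)%VF }.

Definition pm_iso (K : fieldType) d (P : porderType d) (F G : pmodule K P) :
    Prop :=
  exists (phi : pmorphism F G) (psi : pmorphism G F),
    (forall p, (psi p \o phi p)%VF = \1%VF) /\
    (forall p, (phi p \o psi p)%VF = \1%VF).

Section Pullback.
Context (K : fieldType) d (P : porderType d) d' (Q : porderType d').
Variables (f : P -> Q) (f_homo : {homo f : s t / (s <= t)%O}) (F : pmodule K Q).

Definition pm_pullback : pmodule K P :=
  @PModule K d P (fun p => F (f p))
    (fun s t h => pm_map F (f_homo h))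
    (fun s h => pm_id F (f_homo h))
    (fun s t u h1 h2 h3 => pm_comp F (f_homo h1) (f_homo h2) (f_homo h3)).

End Pullback.

Record translation d (P : porderType d) := Translation {
  tr_fun :> P -> P;
  tr_homo : {homo tr_fun : s t / (s <= t)%O};
  tr_ge : forall p, (p <= tr_fun p)%O }.

Definition translate (K : fieldType) d (P : porderType d) (M : pmodule K P)
  (Lam : translation P) : pmodule K P := pm_pullback (tr_homo Lam) M.

Lemma tr_ge2 d (P : porderType d) (Gam Lam : translation P) (p : P) :
  (p <= Gam (Lam p))%O.
Proof. exact: le_trans (tr_ge Lam p) (tr_ge Gam (Lam p)). Qed.

Definition interleaved (K : fieldType) d (P : porderType d)
    (Gam Lam : translation P) (F G : pmodule K P) : Prop :=
  exists (phi : pmorphism F (translate G Lam))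
         (psi : pmorphism G (translate F Gam)),
    (forall p, (psi (Lam p) \o phi p)%VF = pm_map F (tr_ge2 Gam Lam p)) /\
    (forall p, (phi (Gam p) \o psi p)%VF = pm_map G (tr_ge2 Lam Gam p)).

Section Convex.
Context (K : fieldType).

Definition line_if (c : bool) : vectType K :=
  if c then (K^o : vectType K) else ('rV[K]_0 : vectType K).

Definition line_map (c c' : bool) : 'Hom(line_if c, line_if c') :=
  match c, c' return 'Hom(line_if c, line_if c') with
  | true, true => \1%VF
  | _, _ => 0
  end.

Lemma line_map_id (c : bool) : line_map c c = \1%VF.
Proof.
case: c => //=; apply/lfunP => x; rewrite lfunE /=.
by apply/rowP => -[].
Qed.

Lemma line_map_comp (c1 c2 c3 : bool) : (c1 -> c3 -> c2) ->
  line_map c1 c3 = (line_map c2 c3 \o line_map c1 c2)%VF.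
Proof.
case: c1 c2 c3 => [] [] [] //= h; rewrite ?comp_lfun1r ?comp_lfun0l //.
- by have := h isT isT.
- by rewrite comp_lfun0r.
Qed.

Context (R : realType) (r r' : R).

Definition in_seg (t : R) : bool := (r <= t) && (t < r').

Lemma convex_comp (s t u : R) : s <= t -> t <= u ->
  line_map (in_seg s) (in_seg u) =
  (line_map (in_seg t) (in_seg u) \o line_map (in_seg s) (in_seg t))%VF.
Proof.
move=> st tu; apply: line_map_comp => /andP[rs _] /andP[_ ur].
by rewrite /in_seg (le_trans rs st) (le_lt_trans tu ur).
Qed.

Definition convex_module : pmodule K R :=
  @PModule K _ R (fun t => line_if (in_seg t))
    (fun s t _ => line_map (in_seg s) (in_seg t))
    (fun s _ => line_map_id (in_seg s))
    (fun s t u st tu _ => convex_comp st tu).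

End Convex.

Section DirectSum.
Context (K : fieldType).

Section PairLfun.
Context (U V U' V' : vectType K) (f : 'Hom(U, U')) (g : 'Hom(V, V')).

Definition pair_map (x : U * V) : U' * V' := (f x.1, g x.2).

Fact pair_map_is_linear : linear pair_map.
Proof. by move=> a x y; rewrite /pair_map /= !linearP. Qed.

HB.instance Definition _ :=
  GRing.isLinear.Build K (U * V)%type (U' * V')%type _ pair_map
    pair_map_is_linear.

Definition pair_lfun : 'Hom((U * V)%type, (U' * V')%type) := linfun pair_map.

End PairLfun.

Lemma pair_lfun1 (U V : vectType K) : pair_lfun (\1 : 'End(U)) (\1 : 'End(V)) = \1%VF.
Proof. by apply/lfunP => -[x y]; rewrite !lfunE /= /pair_map !lfunE. Qed.

Lemma pair_lfun_comp (U V U' V' U'' V'' : vectType K)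
  (f : 'Hom(U, U')) (g : 'Hom(V, V')) (f' : 'Hom(U', U'')) (g' : 'Hom(V', V'')) :
  pair_lfun (f' \o f) (g' \o g) = (pair_lfun f' g' \o pair_lfun f g)%VF.
Proof.
by apply/lfunP => -[x y]; rewrite !lfunE /= !lfunE /= /pair_map /= !lfunE.
Qed.

Context d (P : porderType d).

Definition zero_module : pmodule K P.
Proof.
refine (@PModule K d P (fun=> ('rV[K]_0 : vectType K)) (fun _ _ _ => \1%VF)
  (fun _ _ => erefl) _).
by move=> *; rewrite comp_lfun1l.
Defined.

Definition sum_module (F G : pmodule K P) : pmodule K P.
Proof.
refine (@PModule K d P (fun p => (F p * G p)%type : vectType K)
  (fun s t h => pair_lfun (pm_map F h) (pm_map G h)) _ _).
- by move=> s h; rewrite !pm_id pair_lfun1.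
- move=> s t u h1 h2 h3.
  by rewrite (pm_comp F h1 h2) (pm_comp G h1 h2) pair_lfun_comp.
Defined.

End DirectSum.

Definition barcode_module (K : fieldType) (R : realType) (B : seq (R * R)) :
    pmodule K R :=
  foldr (fun J F => sum_module (convex_module K J.1 J.2) F) (zero_module K R) B.

Definition endpoints_in (K : fieldType) (R : realType) (L : set R)
    (F : pmodule K R) : Prop :=
  exists B : seq (R * R),
    (forall J, J \in B -> [/\ J.1 < J.2, L J.1 & L J.2]) /\
    pm_iso F (barcode_module K B).

Section Shift.
Context (R : realType) (e : R) (e_ge0 : 0 <= e).

Fact shift_homo : {homo (fun t : R => t + e) : s t / (s <= t)%O}.
Proof. by move=> s t; rewrite lerD2r. Qed.

Fact shift_ge (t : R) : (t <= t + e)%O.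
Proof. by rewrite lerDl. Qed.

Definition shift_tr : translation R := Translation shift_homo shift_ge.

End Shift.

Definition interleaving_dist (K : fieldType) (R : realType)
    (F G : pmodule K R) : \bar R :=
  ereal_inf [set e%:E | e in [set e : R |
    exists e_ge0 : 0 <= e, interleaved (shift_tr e_ge0) (shift_tr e_ge0) F G]].

(* [None] plays the role of the element at infinity. *)
Definition with_top (P : Type) : Type := option P.

HB.instance Definition _ (P : choiceType) :=
  Choice.copy (with_top P) (option P).
HB.instance Definition _ (P : finType) :=
  Finite.copy (with_top P) (option P).

Section WithTopOrder.
Context d (P : porderType d).

Definition with_top_le (x y : with_top P) : bool :=
  match x, y with
  | _, None => true
  | None, Some _ => false
  | Some p, Some q => (p <= q)%O
  end.

Fact with_top_le_refl : reflexive with_top_le.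
Proof. by case=> //= p; rewrite lexx. Qed.

Fact with_top_le_anti : antisymmetric with_top_le.
Proof. by case=> [p|] [q|] //= /le_anti ->. Qed.

Fact with_top_le_trans : transitive with_top_le.
Proof. by case=> [p|] [q|] [r|] //=; apply: le_trans. Qed.

HB.instance Definition _ := @Order.Le_isPOrder.Build d (with_top P)
  with_top_le with_top_le_refl with_top_le_anti with_top_le_trans.

End WithTopOrder.

Section Extend.
Context (K : fieldType) d (P : porderType d) (F : pmodule K P).

Definition ext_obj (x : with_top P) : vectType K :=
  if x is Some p then F p else ('rV[K]_0 : vectType K).

Definition ext_map (x y : with_top P) :
    (x <= y)%O -> 'Hom(ext_obj x, ext_obj y) :=
  match x, y return with_top_le x y -> 'Hom(ext_obj x, ext_obj y) with
  | Some p, Some q => fun h => @pm_map _ _ _ F p q h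
  | _, _ => fun _ => 0
  end.

Fact ext_id (x : with_top P) (h : (x <= x)%O) : ext_map h = \1%VF.
Proof.
case: x h => [p|] h /=; first exact: pm_id.
by apply/lfunP => v; apply/rowP => -[].
Qed.

Fact ext_comp (x y z : with_top P) (h1 : (x <= y)%O) (h2 : (y <= z)%O)
  (h3 : (x <= z)%O) : ext_map h3 = (ext_map h2 \o ext_map h1)%VF.
Proof.
case: x y z h1 h2 h3 => [p|] [q|] [r|] //= h1 h2 h3;
  by [exact: pm_comp | rewrite comp_lfun0l | rewrite comp_lfun0r].
Qed.

Definition ext_module : pmodule K (with_top P) := PModule ext_id ext_comp.

End Extend.

HB.instance Definition _ d (T : porderType d) (X : {fset T}) :=
  [SubChoice_isSubPOrder of X by <: with d].

Definition pm_restrict (K : fieldType) (R : realType) (X : {fset R})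
    (F : pmodule K R) : pmodule K X :=
  @pm_pullback K _ X _ R (fun p => val p) (fun _ _ h => h) F.

Section DiscreteMetric.
Context (R : realType) (X : {fset R}) (b : R).

(* The largest element of [X]; [p] only witnesses that [X] is nonempty. *)
Definition fset_max (p : X) : R := \big[Num.max/val p]_(q : X) val q.

(* The distance from the largest element of [X] to infinity is [b]. *)
Definition top_dist (x y : with_top X) : R :=
  match x, y with
  | Some p, Some q => `|val p - val q|
  | Some p, None | None, Some p => fset_max p - val p + b
  | None, None => 0
  end.

Definition height (Lam : translation (with_top X)) : R :=
  \big[Num.max/0]_(p : with_top X) top_dist p (Lam p).

Definition discrete_dist (K : fieldType) (F G : pmodule K X) : \bar R :=
  ereal_inf [set e%:E | e in [set e : R |
    exists Gam Lam : translation (with_top X),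
      [/\ height Gam <= e, height Lam <= e &
          interleaved Gam Lam (ext_module F) (ext_module G)]]].

End DiscreteMetric.

(* Sets of finite subsets of [T], with the discrete topology. *)
Definition simplex_sets (T : choiceType) : Type := set {fset T}.

HB.instance Definition _ (T : choiceType) :=
  Choice.copy (simplex_sets T) (set {fset T}).
HB.instance Definition _ (T : choiceType) :=
  isPointed.Build (simplex_sets T) set0.
HB.instance Definition _ (T : choiceType) :=
  hasNbhs.Build (simplex_sets T) principal_filter.
HB.instance Definition _ (T : choiceType) :=
  Discrete_ofNbhs.Build (simplex_sets T) erefl.
HB.instance Definition _ (T : choiceType) :=
  DiscreteUniform_ofNbhs.Build (simplex_sets T).

Section Rips.
Context (R : realType) (T : metricType R).

Definition rips (D : {fset T}) (e : R) : simplex_sets T :=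
  [set s : {fset T} | [/\ s != fset0, (s `<=` D)%fset &
    forall x y, x \in s -> y \in s -> mdist x y <= e]].

(* The limit in the discrete topology; it exists because the complex takes
   finitely many values and grows with the scale. *)
Definition rips_left_lim (D : {fset T}) (e : R) : simplex_sets T :=
  lim (rips D t @[t --> e^'-]).

Definition jump_discontinuities (D : {fset T}) : set R :=
  [set e | 0 < e /\ rips D e <> rips_left_lim D e].

Definition all_jumps (m : nat) (D : 'I_m -> {fset T}) : set R :=
  \bigcup_(i in [set: 'I_m]) jump_discontinuities (D i).

End Rips.

Definition Delta (R : realType) (L : set R) : set {fset R} :=
  [set X | L `<=` [set` X]].

(* The filter of tails of the directed set [Delta L], so that convergence along
   it is convergence of nets indexed by [Delta L]. *)
Definition Delta_net (R : realType) (L : set R) : set_system {fset R} :=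
  filter_from (Delta L) (fun X0 => [set X | (X0 `<=` X)%fset]).

(* Main.v *)
Require Import Defs.
From HB Require Import structures.
From mathcomp Require Import all_boot all_order all_algebra finmap lra.
From mathcomp Require Import all_classical all_reals all_analysis.
Import Order.TTheory GRing.Theory Num.Theory.
Import numFieldNormedType.Exports.
Local Open Scope classical_set_scope.
Local Open Scope ring_scope.

Set Implicit Arguments.
Unset Strict Implicit.
Unset Printing Implicit Defensive.

(** The limit holds because the discrete distance never falls below the
    classical one, and exceeds it by at most the mesh of [X] once [X] is fine
    enough.

    Everything rests on one feature of a module whose endpoints lie in [L]: its
    structure maps are invertible across any interval free of points of [L],
    and it vanishes before the first point of [L] and from the last one on
    ([endpoints_in_piecewise_constant]).  Hence, when [X] contains [L], the
    module is determined by its restriction to [X]: the value at [t] is the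
    value at the largest point of [X] below [t].

    Lower bound ([interleaving_dist_le_discrete]).  Let [Gam], [Lam] have height
    at most [e] and interleave the restrictions.  At [t], go back to the largest
    point [p <= t] of [X], apply the discrete morphism into the value at
    [Lam p], and push forward to [t + e], which is possible since
    [Lam p <= p + e <= t + e].  If [Lam p] is infinity, the height bound puts
    the whole of [X] before [t + e], so the target vanishes there and the zero
    map is right.  This yields an interleaving by the shift by [e] itself, so no
    error term appears.

    Upper bound ([discrete_dist_le_interleaving]).  Given an interleaving by the
    shift by [e], both modules live on an interval from [a] to [top].  Let [X]
    contain a subdivision of this interval of mesh [d].  Send each [p] of [X] in
    the interval to the first point of [X] after [p + e], but never beyond
    [top], and fix the other points.  The height is at most [e + d].  Composing
    the given morphisms with structure maps gives the discrete interleaving: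
    where the cut at [top] is active, or where a point is fixed, one of the
    spaces involved is zero.  Fixing the points outside the interval is what
    keeps the height independent of the position of the points of [X] there
    and of the weight [b] of the last edge.

    Finally, the directed set is nonempty because a jump of a Vietoris-Rips
    complex is a distance between two data points ([jump_is_distance]), so that
    [L] is finite. *)

(** * Linear maps from and to zero spaces *)

Section LinearMaps.
Context (K : fieldType).
Implicit Types U V W : vectType K.

Definition zero_space V : Prop := forall v : V, v = 0.

Lemma zero_space_rV0 : zero_space 'rV[K]_0.
Proof. by move=> v; apply/rowP => -[]. Qed.

Lemma eq_to_zero U V (f g : 'Hom(U, V)) : zero_space V -> f = g.
Proof. by move=> V0; apply/lfunP => u; rewrite (V0 (f u)) (V0 (g u)). Qed.

Lemma eq_from_zero U V (f g : 'Hom(U, V)) : zero_space U -> f = g.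
Proof. by move=> U0; apply/lfunP => u; rewrite (U0 u) !linear0. Qed.

Definition invertible U V (f : 'Hom(U, V)) : Prop :=
  exists g : 'Hom(V, U), (g \o f)%VF = \1%VF /\ (f \o g)%VF = \1%VF.

Lemma invertible_pair U V U' V' (f : 'Hom(U, U')) (g : 'Hom(V, V')) :
  invertible f -> invertible g -> invertible (pair_lfun f g).
Proof.
move=> [f' [ff' f'f]] [g' [gg' g'g]]; exists (pair_lfun f' g').
by rewrite -!pair_lfun_comp ff' f'f gg' g'g !pair_lfun1.
Qed.

End LinearMaps.

(** * Structure maps without order proofs *)

Section TotalMap.
Context (K : fieldType) d (P : porderType d).
Implicit Types F G : pmodule K P.

(** Extending the structure maps by zero to unordered pairs removes the order
    proofs from the terms, so that composites can be rewritten freely. *)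
Definition total_map F (s t : P) : 'Hom(F s, F t) :=
  if pselect (s <= t)%O is left h then pm_map F h else 0.

Lemma total_mapE F (s t : P) (h : (s <= t)%O) : total_map F s t = pm_map F h.
Proof.
rewrite /total_map; case: pselect => // h'.
by rewrite (bool_irrelevance h' h).
Qed.

Lemma total_map_comp F (s t u : P) : (s <= t)%O -> (t <= u)%O ->
  (total_map F t u \o total_map F s t)%VF = total_map F s u.
Proof.
move=> st tu; have su := le_trans st tu.
by rewrite (total_mapE _ st) (total_mapE _ tu) (total_mapE _ su) -pm_comp.
Qed.

Lemma total_map_nat F G (Lam : translation P)
    (phi : pmorphism F (translate G Lam)) (s t : P) : (s <= t)%O ->
  (total_map G (Lam s) (Lam t) \o phi s)%VF = (phi t \o total_map F s t)%VF.
Proof.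
move=> st; rewrite (total_mapE _ st) (total_mapE _ (tr_homo Lam st)).
exact: (pmor_nat phi st).
Qed.

End TotalMap.

(** * Modules with finitely many critical values *)

Section PiecewiseConstant.
Context (K : fieldType) (R : realType).
Implicit Types (F G : pmodule K R) (A : set R).

(** A summand supported on a left-closed, right-open interval changes upon
    reaching each endpoint, whence the intervals open at [s] and closed at [t],
    and the vanishing from the last point of [A] on, that point included. *)
Definition piecewise_constant A F : Prop :=
  (forall s t : R, s <= t -> (forall x, A x -> ~~ (s < x <= t)) ->
     invertible (total_map F s t)) /\
  (forall t : R, (forall x, A x -> t < x) \/ (forall x, A x -> x <= t) ->
     zero_space (F t)).

Lemma piecewise_constant_sub A B F : A `<=` B ->
  piecewise_constant A F -> piecewise_constant B F.
Proof.
move=> AB [inv zero]; split=> [s t st noB|t outB].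
  by apply: inv => // x /AB; exact: noB.
by apply: zero; case: outB => h; [left|right] => x /AB; exact: h.
Qed.

Lemma piecewise_constant_zero A : piecewise_constant A (zero_module K R).
Proof.
split=> [s t st _|t _]; last exact: zero_space_rV0.
by rewrite (total_mapE _ st); exists \1%VF; rewrite comp_lfun1l.
Qed.

Lemma piecewise_constant_convex A (r r' : R) : A r -> A r' ->
  piecewise_constant A (convex_module K r r').
Proof.
move=> Ar Ar'; split=> [s t st noA|t outA].
  rewrite (total_mapE _ st) /=.
  have -> : in_seg r r' t = in_seg r r' s.
    rewrite /in_seg; move: (noA _ Ar) (noA _ Ar') => nr nr'.
    by apply/idP/idP => /andP[? ?]; apply/andP; split; move: nr nr';
       rewrite !negb_and -!leNgt -!ltNge => /orP[] ? /orP[] ?; lra.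
  by exists \1%VF; rewrite line_map_id comp_lfun1l.
rewrite /= /line_if; suff -> : in_seg r r' t = false by exact: zero_space_rV0.
by apply/negP => /andP[rt tr']; case: outA => /[dup] /(_ _ Ar) + /(_ _ Ar'); lra.
Qed.

Lemma piecewise_constant_sum A F G : piecewise_constant A F ->
  piecewise_constant A G -> piecewise_constant A (sum_module F G).
Proof.
move=> [invF zF] [invG zG]; split=> [s t st noA|t outA].
  rewrite (total_mapE _ st) /=.
  by apply: invertible_pair; rewrite -total_mapE; [exact: invF|exact: invG].
by move=> [v w]; rewrite (zF t outA v) (zG t outA w).
Qed.

Lemma piecewise_constant_iso A F G : pm_iso F G -> piecewise_constant A G ->
  piecewise_constant A F.
Proof.
move=> [phi [psi [psiphi phipsi]]] [inv zero]; split=> [s t st noA|t outA].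
  have [g [gl gr]] := inv s t st noA.
  rewrite (total_mapE G st) in gl gr; rewrite (total_mapE F st).
  exists (psi s \o g \o phi t)%VF; split.
    rewrite -comp_lfunA -(pmor_nat phi st) -comp_lfunA (comp_lfunA g).
    by rewrite gl comp_lfun1l psiphi.
  rewrite !comp_lfunA (pmor_nat psi st) -(comp_lfunA (psi t)) gr comp_lfun1r.
  exact: psiphi.
move=> v; have /lfunP/(_ v) := psiphi t.
by rewrite comp_lfunE id_lfunE (zero t outA (phi t v)) linear0.
Qed.

Lemma endpoints_in_piecewise_constant A F :
  endpoints_in A F -> piecewise_constant A F.
Proof.
move=> [B [BA /piecewise_constant_iso]]; apply.
elim: B BA => [_|J B IH BA]; first exact: piecewise_constant_zero.
apply: piecewise_constant_sum; last by apply: IH => J' ?; apply/BA/mem_behead.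
by have [_ ? ?] := BA J (mem_head _ _); exact: piecewise_constant_convex.
Qed.

End PiecewiseConstant.

(** * Recovering a module from its restriction to a finite set *)

Section FromGrid.
Context (K : fieldType) (R : realType) (X : {fset R}).
Implicit Types (F G : pmodule K R).

Definition on_grid F := ext_module (pm_restrict X F).

(** At infinity this asks that all of [X] has been passed, which is the region
    where a module with endpoints in [X] vanishes, as its extension does at
    infinity. *)
Definition below (x : with_top X) (t : R) : Prop :=
  if x is Some p then val p <= t else forall p : X, val p <= t.

Definition from_grid F (x : with_top X) (t : R) : 'Hom(on_grid F x, F t) :=
  match x return 'Hom(on_grid F x, F t) with
  | Some p => total_map F (val p) t
  | None => 0
  end.

Lemma below_le x s t : below x s -> s <= t -> below x t.
Proof.
case: x => [p|] /= h st; first exact: le_trans st.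
by move=> p; exact: le_trans st.
Qed.

Lemma below_mono x y t : (x <= y)%O -> below y t -> below x t.
Proof.
case: x y => [p|] [q|] // pq /=; last exact.
exact: le_trans.
Qed.

Lemma from_grid_comp F x s t : below x s -> s <= t ->
  (total_map F s t \o from_grid F x s)%VF = from_grid F x t.
Proof.
case: x => [p|] /= h st; first exact: total_map_comp.
by rewrite comp_lfun0r.
Qed.

(** Compatibility with the extended module.  The case that needs the hypothesis
    on [F] is the passage to infinity, where the left side is zero: the right
    side is zero too because [F t] is. *)
Lemma from_grid_map F x y t (h : (x <= y)%O) :
  piecewise_constant [set` X] F -> below y t ->
  (from_grid F y t \o pm_map (on_grid F) h)%VF = from_grid F x t.
Proof.
move=> [_ zero]; case: y h => [q|] h yt; last first.
  apply: eq_to_zero; apply: zero; right => x0 /= x0X.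
  exact: (yt [` x0X]%fset).
case: x h => [p|] //= h; rewrite -total_mapE.
exact: total_map_comp.
Qed.

Lemma grid_floor (t : R) : (forall p : X, t < val p) \/
  exists2 p : X, val p <= t & forall q : X, val q <= t -> val q <= val p.
Proof.
have [p pt|none] := pickP [pred p : X | val p <= t]; last first.
  by left=> p; have /= := none p; rewrite leNgt => /negbFE.
by right; case: (arg_maxP (fun q : X => val q) pt) => q qt qmax; exists q.
Qed.

Lemma floor_invertible F (p : X) t : piecewise_constant [set` X] F ->
  val p <= t -> (forall q : X, val q <= t -> val q <= val p) ->
  invertible (total_map F (val p) t).
Proof.
move=> [inv _] pt pmax; apply: inv => // x /= xX.
apply/negP => /andP[px xt]; have := pmax [` xX]%fset xt.
by rewrite /= leNgt px.
Qed.

Lemma zero_before_grid F t : piecewise_constant [set` X] F ->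
  (forall p : X, t < val p) -> zero_space (F t).
Proof.
move=> [_ zero] tX; apply: zero; left => x /= xX.
exact: (tX [` xX]%fset).
Qed.

(** Either [F t] is zero, or the largest point of [X] before [t] already gives an
    invertible map onto [F t].  This reduces every identity between maps out of
    [F t] to the grid. *)
Lemma from_grid_epi F (V : vectType K) t (f g : 'Hom(F t, V)) :
  piecewise_constant [set` X] F ->
  (forall x, below x t ->
     (f \o from_grid F x t)%VF = (g \o from_grid F x t)%VF) ->
  f = g.
Proof.
move=> FX fg; case: (grid_floor t) => [tX|[p pt pmax]].
  exact/eq_from_zero/(zero_before_grid FX).
have [h [_ hr]] := floor_invertible FX pt pmax.
have /= := fg (Some p) pt => /(congr1 (fun k => (k \o h)%VF)).
by rewrite -!comp_lfunA hr !comp_lfun1r.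
Qed.

(** The positive weight of the last edge is what makes this work at infinity: a
    point sent there by a translation of height at most [e] is at distance less
    than [e] from the largest point of [X]. *)
Lemma below_height (b e : R) (Lam : translation (with_top X)) x t :
  0 < b -> height b Lam <= e -> below x t -> below (Lam x) (t + e).
Proof.
move=> b_gt0 he xt.
have : top_dist b x (Lam x) <= e.
  by apply: le_trans he; apply: (le_bigmax 0 (fun p => top_dist b p (Lam p))).
have := tr_ge Lam x; case: x xt => [p|] /= xt; case: (Lam _) => [q|] //= pq.
- by rewrite distrC ger0_norm ?subr_ge0//= => ?; lra.
- move=> dist q; have : val q <= fset_max p by apply: (le_bigmax _ val).
  by rewrite /= in dist xt * => ?; lra.
- by move=> e_ge0 q; have /= := xt q; lra.
Qed.

(** The value at [t] must be the discrete component at the largest point of [X]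
    before [t], transported by the invertible structure map; the naturality of
    [phi] takes care of the earlier grid points. *)
Lemma extend_from_grid F G (b e : R) (Lam : translation (with_top X))
    (phi : pmorphism (on_grid F) (translate (on_grid G) Lam)) t :
  piecewise_constant [set` X] F -> piecewise_constant [set` X] G ->
  0 < b -> height b Lam <= e ->
  exists f : 'Hom(F t, G (t + e)), forall x, below x t ->
    (f \o from_grid F x t)%VF = (from_grid G (Lam x) (t + e) \o phi x)%VF.
Proof.
move=> FX GX b0 he; case: (grid_floor t) => [tX|[p pt pmax]].
  exists 0 => -[p|] xt; first by have := tX p; rewrite ltNge xt.
  by apply: eq_from_zero; exact: zero_space_rV0.
have [h [hl _]] := floor_invertible FX pt pmax.
exists (from_grid G (Lam (Some p)) (t + e) \o phi (Some p) \o h)%VF.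
case=> [q|] xt; last by apply: eq_from_zero; exact: zero_space_rV0.
have qp : (Some q <= Some p :> with_top X)%O by exact: pmax.
have -> : from_grid F (Some q) t =
    (total_map F (val p) t \o pm_map (on_grid F) qp)%VF.
  by symmetry; exact: (@from_grid_map _ (Some q) (Some p)).
rewrite -!comp_lfunA (comp_lfunA h) hl comp_lfun1l -(pmor_nat phi qp).
rewrite comp_lfunA; congr (_ \o _)%VF.
by apply: from_grid_map => //; exact: (@below_height b e _ (Some p)).
Qed.

End FromGrid.

(** * A discrete interleaving extends to the line *)

Section ExtendInterleaving.
Context (K : fieldType) (R : realType) (X : {fset R}).
Implicit Types (F G : pmodule K R).

(** The components are determined by their values on the grid, so naturality
    follows from that of [from_grid]. *)
Lemma extend_morphism F G (b e : R) (e_ge0 : 0 <= e)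
    (Lam : translation (with_top X))
    (phi : pmorphism (on_grid X F) (translate (on_grid X G) Lam)) :
  piecewise_constant [set` X] F -> piecewise_constant [set` X] G ->
  0 < b -> height b Lam <= e ->
  exists f : pmorphism F (translate G (shift_tr e_ge0)),
    forall t x, below x t ->
    (f t \o from_grid F x t)%VF = (from_grid G (Lam x) (t + e) \o phi x)%VF.
Proof.
move=> FX GX b0 he.
pose f t := projT1 (cid (extend_from_grid phi t FX GX b0 he)).
have fE t x : below x t -> (f t \o from_grid F x t)%VF =
    (from_grid G (Lam x) (t + e) \o phi x)%VF.
  by rewrite /f; case: cid => /= g gE; exact: gE.
have f_nat s t (h : (s <= t)%O) :
    (pm_map (translate G (shift_tr e_ge0)) h \o f s)%VF =
    (f t \o pm_map F h)%VF.
  apply: (from_grid_epi FX) => x xs.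
  rewrite -!comp_lfunA -(total_mapE F) from_grid_comp// fE// fE; last first.
    exact: below_le xs h.
  rewrite comp_lfunA -[pm_map _ _](total_mapE G (shift_homo e h)).
  rewrite from_grid_comp ?lerD2r//.
  exact: (below_height b0 he xs).
by exists (PMorphism f_nat).
Qed.

(** Tested on a grid point [x] below [t], the composite at [t] passes through
    [Lam x], which is below [t + e], so the defining property of the extension
    applies twice and leaves the discrete identity. *)
Lemma interleaved_extend F G (b e : R) (e_ge0 : 0 <= e)
    (Gam Lam : translation (with_top X)) :
  piecewise_constant [set` X] F -> piecewise_constant [set` X] G ->
  0 < b -> height b Gam <= e -> height b Lam <= e ->
  interleaved Gam Lam (on_grid X F) (on_grid X G) ->
  interleaved (shift_tr e_ge0) (shift_tr e_ge0) F G.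
Proof.
move=> FX GX b0 hGam hLam [phi [psi [psiphi phipsi]]].
have [f fE] := extend_morphism e_ge0 phi FX GX b0 hLam.
have [g gE] := extend_morphism e_ge0 psi GX FX b0 hGam.
exists f, g; split=> t.
- apply: (from_grid_epi FX) => x xt.
  rewrite -(total_mapE F) from_grid_comp//; last exact: tr_ge2.
  have xt' := below_height b0 hLam xt.
  rewrite -comp_lfunA fE// comp_lfunA (gE _ _ xt') -comp_lfunA psiphi.
  rewrite from_grid_map//; exact: (below_height b0 hGam xt').
- apply: (from_grid_epi GX) => x xt.
  rewrite -(total_mapE G) from_grid_comp//; last exact: tr_ge2.
  have xt' := below_height b0 hGam xt.
  rewrite -comp_lfunA gE// comp_lfunA (fE _ _ xt') -comp_lfunA phipsi.
  rewrite from_grid_map//; exact: (below_height b0 hLam xt').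
Qed.

Lemma height_ge0 (b : R) (Lam : translation (with_top X)) : 0 <= height b Lam.
Proof. exact: bigmax_ge_id. Qed.

Lemma interleaving_dist_le_discrete F G (b : R) :
  piecewise_constant [set` X] F -> piecewise_constant [set` X] G -> 0 < b ->
  (interleaving_dist F G <=
   discrete_dist b (pm_restrict X F) (pm_restrict X G))%E.
Proof.
move=> FX GX b0; apply: le_ereal_inf_tmp => _ [e [Gam [Lam [hG hL FG]]] <-].
apply: ereal_inf_lbound; exists e => //.
have e_ge0 : 0 <= e by apply: le_trans hG; exact: height_ge0.
by exists e_ge0; exact: interleaved_extend hG hL FG.
Qed.

End ExtendInterleaving.

(** * A shift induces a translation of a fine grid *)

Section RoundingUp.
Context (R : realType) (X : {fset R}) (a e d : R) (top : X).
Hypotheses (e_ge0 : 0 <= e) (d_ge0 : 0 <= d).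
Hypothesis grid : forall t, a <= t <= val top ->
  exists2 p : X, t <= val p & val p <= t + d.

(** The cut at [top] guarantees that some point of [X] qualifies, and keeps the
    distance to the next point of [X] under the control of [grid]. *)
Definition round_up (t : R) : X :=
  [arg min_(q < top | Num.min t (val top) <= val q) val q]%O.

Lemma round_upP t : Num.min t (val top) <= val (round_up t) /\
  forall q : X, Num.min t (val top) <= val q -> val (round_up t) <= val q.
Proof.
rewrite /round_up; case: arg_minP => [|q qt qmin]; last by [].
by rewrite ge_min lexx orbT.
Qed.

Definition snap (p : X) : X :=
  if a <= val p < val top then round_up (val p + e) else p.

Lemma snap_ge p : val p <= val (snap p).
Proof.
rewrite /snap; case: ifP => // /andP[ap pm].
apply: le_trans (proj1 (round_upP _)).
by rewrite le_min lerDl e_ge0 ltW.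
Qed.

Lemma snap_homo : {homo snap : p q / (p <= q)%O}.
Proof.
move=> p q pq; have {}pq : val p <= val q by [].
suff : val (snap p) <= val (snap q) by [].
rewrite {1}/snap; case: ifP => [/andP[ap pm]|_]; last first.
  exact: le_trans (snap_ge q).
have [pe min_pe] := round_upP (val p + e).
have [qm|mq] := ltP (val q) (val top); last first.
  by apply: min_pe; rewrite ge_min (le_trans mq (snap_ge q)) orbT.
rewrite /snap (le_trans ap pq) qm; apply: min_pe.
apply: le_trans (proj1 (round_upP _)).
by rewrite le_min ge_min lerD2r pq ge_min lexx orbT.
Qed.

Definition snap_top (x : with_top X) : with_top X :=
  if x is Some p then Some (snap p) else None.

Fact snap_top_homo : {homo snap_top : x y / (x <= y)%O}.
Proof. by move=> [p|] [q|] //; exact: snap_homo. Qed.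

Fact snap_top_ge (x : with_top X) : (x <= snap_top x)%O.
Proof. by case: x => [p|] //; exact: snap_ge. Qed.

Definition snap_tr : translation (with_top X) :=
  Translation snap_top_homo snap_top_ge.

Lemma height_snap (b : R) : height b snap_tr <= e + d.
Proof.
have ed0 : 0 <= e + d by exact: addr_ge0.
apply: bigmax_le => // -[p|] _ //=.
rewrite distrC ger0_norm ?subr_ge0 ?snap_ge// /snap.
case: ifP => [/andP[ap pm]|_]; last by rewrite subrr.
have [_ min_pe] := round_upP (val p + e).
have [|q q1 q2] := grid (t := Num.min (val p + e) (val top)).
  by rewrite le_min ge_min lexx orbT (ltW (le_lt_trans ap pm)) (le_trans ap)// lerDl.
have := min_pe q q1; have : Num.min (val p + e) (val top) <= val p + e.
  by rewrite ge_min lexx.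
by move: q2 => /= ? ? ?; lra.
Qed.

(** In the second case the modules vanish at [snap p], so the target of any map
    there is irrelevant. *)
Lemma snap_shift p : a <= val p < val top ->
  val p + e <= val (snap p) \/ val top <= val (snap p).
Proof.
move=> ap; have := proj1 (round_upP (val p + e)).
by rewrite /snap ap ge_min => /orP[]; [left|right].
Qed.

Section Interleaving.
Context (K : fieldType).
Implicit Types F G : pmodule K R.

Definition supported F : Prop :=
  forall t, ~~ (a <= t < val top) -> zero_space (F t).

(** [snap p] may be smaller than [val p + e], and [total_map] is then zero.  This is
    the right map: either the cut at [top] is active and the target is zero, or
    [p] is a fixed point and the source is zero. *)
Definition snap_component F G
    (phi : pmorphism F (translate G (shift_tr e_ge0))) (x : with_top X) :
    'Hom(on_grid X F x, translate (on_grid X G) snap_tr x) :=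
  match x return 'Hom(on_grid X F x, translate (on_grid X G) snap_tr x) with
  | Some p => (total_map G (val p + e) (val (snap p)) \o phi (val p))%VF
  | None => 0
  end.

Lemma snap_component_nat F G
    (phi : pmorphism F (translate G (shift_tr e_ge0)))
    (x y : with_top X) (h : (x <= y)%O) :
  supported F -> supported G ->
  (pm_map (translate (on_grid X G) snap_tr) h \o snap_component phi x =
   snap_component phi y \o pm_map (on_grid X F) h)%VF.
Proof.
move=> Fs Gs; case: x h => [p|] h; last by apply: eq_from_zero; exact: zero_space_rV0.
case: y h => [q|] h; last by apply: eq_to_zero; exact: zero_space_rV0.
have pq : val p <= val q by [].
have spq : val (snap p) <= val (snap q) by exact: snap_homo.
have [qm|mq] := ltP (val q) (val top); last first.
  apply/eq_to_zero/Gs; rewrite negb_and -!leNgt orbC.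
  by rewrite (le_trans mq (snap_ge q)).
have [ap|pa] := leP a (val p); last first.
  by apply/eq_from_zero/Fs; rewrite negb_and -ltNge pa.
have aq := le_trans ap pq; have pm := le_lt_trans pq qm.
have [mq|qm'] := leP (val top) (val (snap q)).
  by apply/eq_to_zero/Gs; rewrite negb_and -!leNgt mq orbT.
have [pe|mp] := snap_shift (introT andP (conj ap pm)); last first.
  by have := le_lt_trans (le_trans mp spq) qm'; rewrite ltxx.
have [qe|mq] := snap_shift (introT andP (conj aq qm)); last first.
  by have := le_lt_trans mq qm'; rewrite ltxx.
have -> : pm_map (translate (on_grid X G) snap_tr) h =
    total_map G (val (snap p)) (val (snap q)).
  symmetry; exact: (total_mapE G (snap_top_homo h : val (snap p) <= val (snap q))).
have -> : pm_map (on_grid X F) h = total_map F (val p) (val q).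
  by symmetry; exact: (total_mapE F (h : val p <= val q)).
rewrite /=.
rewrite -comp_lfunA -(total_map_nat phi pq)/= !comp_lfunA.
by rewrite !total_map_comp// lerD2r.
Qed.

(** Once the cases with a zero source or target are set aside, [snap] is at least
    the shift at both steps, and the naturality of [psi] moves the first rounding
    past it. *)
Lemma snap_component_comp F G
    (phi : pmorphism F (translate G (shift_tr e_ge0)))
    (psi : pmorphism G (translate F (shift_tr e_ge0))) (x : with_top X) :
  supported F -> supported G ->
  (forall t, (psi (t + e) \o phi t)%VF =
     pm_map F (tr_ge2 (shift_tr e_ge0) (shift_tr e_ge0) t)) ->
  (snap_component psi (snap_tr x) \o snap_component phi x)%VF =
  pm_map (on_grid X F) (tr_ge2 snap_tr snap_tr x).
Proof.
move=> Fs Gs psiphi; case: x => [p|]; last first.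
  by apply: eq_from_zero; exact: zero_space_rV0.
have p1 := snap_ge p; have p2 := snap_ge (snap p).
have [/andP[ap pm]|pout] := boolP (a <= val p < val top); last first.
  exact/eq_from_zero/Fs.
have [m2|m2] := leP (val top) (val (snap (snap p))).
  by apply/eq_to_zero/Fs; rewrite negb_and -!leNgt m2 orbT.
have m1 := le_lt_trans p2 m2.
have [pe|mp] := snap_shift (introT andP (conj ap pm)); last first.
  by have := le_lt_trans mp m1; rewrite ltxx.
have [pe'|mp] := snap_shift (introT andP (conj (le_trans ap p1) m1)); last first.
  by have := le_lt_trans mp m2; rewrite ltxx.
have -> : pm_map (on_grid X F) (tr_ge2 snap_tr snap_tr (Some p)) =
    total_map F (val p) (val (snap (snap p))).
  symmetry; exact: (total_mapE F (tr_ge2 snap_tr snap_tr (Some p)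
    : val p <= val (snap (snap p)))).
rewrite /=.
rewrite -comp_lfunA (comp_lfunA (psi _)) -(total_map_nat psi pe) /=.
rewrite -comp_lfunA psiphi -total_mapE !total_map_comp//=.
- by apply: le_trans p1 _; rewrite lerDl.
- by rewrite -addrA lerDl addr_ge0.
- by rewrite lerD2r.
Qed.

Lemma interleaved_snap F G : supported F -> supported G ->
  interleaved (shift_tr e_ge0) (shift_tr e_ge0) F G ->
  interleaved snap_tr snap_tr (on_grid X F) (on_grid X G).
Proof.
move=> Fs Gs [phi [psi [psiphi phipsi]]].
exists (PMorphism (fun x y h => snap_component_nat phi h Fs Gs)).
exists (PMorphism (fun x y h => snap_component_nat psi h Gs Fs)).
by split=> x; exact: snap_component_comp.
Qed.

End Interleaving.
End RoundingUp.

(** * Jumps of Vietoris-Rips complexes *)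

Section JumpsFinite.
Context (R : realType) (T : metricType R).

Definition distances (D : {fset T}) : set R :=
  [set mdist p.1 p.2 | p in [set` D] `*` [set` D]].

Lemma distances_finite (D : {fset T}) : finite_set (distances D).
Proof. by apply: finite_image; apply: finite_setX; exact: finite_fset. Qed.

(** If [e] is not a distance, each comparison of a distance with [t] has the same
    outcome as with [e] for [t] just below [e]; as there are finitely many
    distances, the complex is constant on some interval ending at [e]. *)
Lemma jump_is_distance (D : {fset T}) : jump_discontinuities D `<=` distances D.
Proof.
move=> e [_ jump]; apply: contrapT => enD; apply: jump; symmetry.
apply: (lim_near_cst discrete_hausdorff).
have near_same : \forall t \near e^'-, forall p : D * D,
    (mdist (val p.1) (val p.2) <= t) = (mdist (val p.1) (val p.2) <= e).
  apply: filter_forall => -[x y] /=.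
  have [lt|gt|eq] := ltgtP (mdist (val x) (val y)) e.
  - by apply: filterS (nbhs_left_gt lt) => t /ltW.
  - apply: filterS (nbhs_left_lt e) => t te.
    by apply/negbTE; rewrite -ltNge (lt_trans te gt).
  - by case: enD; exists (val x, val y); [split; exact: valP|exact: eq].
apply: filterS near_same => t near_same.
have same x y : x \in D -> y \in D -> (mdist x y <= t) = (mdist x y <= e).
  by move=> xD yD; exact: (near_same ([` xD]%fset, [` yD]%fset)).
apply/seteqP; split=> s [s0 sD ds]; split=> // x y xs ys; have := ds x y xs ys;
  by rewrite same// (fsubsetP sD).
Qed.

Lemma all_jumps_finite (m : nat) (D : 'I_m -> {fset T}) :
  finite_set (all_jumps D).
Proof.
apply: bigcup_finite => // i _.
exact: sub_finite_set (@jump_is_distance (D i)) (distances_finite (D i)).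
Qed.

End JumpsFinite.

(** * The discrete distance on fine grids *)

Section UpperBound.
Context (R : realType).

Lemma finite_set_bounded (L : set R) : finite_set L ->
  exists2 A : R, 0 <= A & forall x, L x -> - A <= x <= A.
Proof.
move=> /finite_fsetP[Y ->]; exists (\big[Num.max/0]_(y : Y) `|val y|).
  exact: bigmax_ge_id.
move=> x /= xY; rewrite -ler_norml.
exact: (le_bigmax 0 (fun y : Y => `|val y|) [` xY]%fset).
Qed.

Definition arith_grid (a d : R) (n : nat) : {fset R} :=
  [fset (a + i%:R * d)%R | i in iota 0 n.+1]%fset.

Lemma mem_arith_grid (a d : R) (n i : nat) :
  (i <= n)%N -> a + i%:R * d \in arith_grid a d n.
Proof.
move=> le_in; apply/imfsetP; exists i => //.
by rewrite /= -[0%N :: _]/(iota 0 n.+1) mem_iota.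
Qed.

Lemma arith_gridP (a d : R) (n : nat) (t : R) :
  0 < d -> a <= t <= a + n%:R * d ->
  exists2 x, x \in arith_grid a d n & t <= x <= t + d.
Proof.
move=> d0 /andP[at_ tn].
have ex : exists i : nat, t <= a + i%:R * d by exists n.
case: (ex_minnP ex) => i ti imin; exists (a + i%:R * d).
  exact: mem_arith_grid (imin n tn).
rewrite ti /=; case: i ti imin => [|i] ti imin; first by rewrite mul0r; lra.
have : a + i%:R * d < t.
  by rewrite ltNge; apply/negP => /imin; rewrite ltnn.
by rewrite -natr1 mulrDl mul1r; lra.
Qed.

(** The set [X0] depends on [L] and [d] only: it is [L] together with an
    arithmetic progression of step [d] that covers [L]. *)
Lemma discrete_dist_le_interleaving (L : set R) (d : R) :
  finite_set L -> 0 < d ->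
  exists2 X0 : {fset R}, Delta L X0 & forall X, (X0 `<=` X)%fset ->
    forall (K : fieldType) (F G : pmodule K R) (b e : R) (e_ge0 : 0 <= e),
    piecewise_constant L F -> piecewise_constant L G ->
    interleaved (shift_tr e_ge0) (shift_tr e_ge0) F G ->
    (discrete_dist b (pm_restrict X F) (pm_restrict X G) <= (e + d)%:E)%E.
Proof.
move=> finL d0; have [A A0 LA] := finite_set_bounded finL.
(* Enough steps of length [d] to go from [- A] to [A]. *)
pose n := Num.bound (2 * A / d); pose top := - A + n%:R * d.
have Atop : A <= top.
  have : 2 * A / d < n%:R by apply/archi_boundP/divr_ge0; [lra|exact: ltW].
  by rewrite ltr_pdivrMr// /top; lra.
exists (fset_set L `|` arith_grid (- A) d n)%fset.
  by move=> x Lx /=; rewrite inE in_fset_set// mem_set.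
move=> X /fsubsetP X0X K F G b e e_ge0 FL GL FG.
have gridX x : x \in arith_grid (- A) d n -> x \in X.
  by move=> xg; apply: X0X; rewrite inE xg orbT.
have topX : top \in X.
  by apply/gridX/mem_arith_grid.
pose topP := [` topX]%fset.
have grid t : - A <= t <= val topP ->
    exists2 p : X, t <= val p & val p <= t + d.
  move=> /(arith_gridP d0)[x /gridX xX /andP[tx xt]].
  by exists [` xX]%fset.
have supp H : piecewise_constant L H -> supported (- A) topP H.
  move=> [_ zero] t; rewrite negb_and -ltNge -leNgt => /orP[tA|tA].
    by apply: zero; left => x /LA/andP[Ax _]; exact: lt_le_trans tA Ax.
  by apply: zero; right => x /LA/andP[_ xA]; rewrite (le_trans xA)// (le_trans Atop).
apply: ereal_inf_lbound; exists (e + d) => //.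
exists (snap_tr (- A) topP e_ge0), (snap_tr (- A) topP e_ge0).
split; [exact: height_snap (ltW d0) grid _|exact: height_snap (ltW d0) grid _|].
by apply: interleaved_snap => //; exact: supp.
Qed.

End UpperBound.

(** * Passing to the limit *)

Section Limit.
Context (R : realType).

Lemma Delta_fset_set (L : set R) : finite_set L -> Delta L (fset_set L).
Proof. by move=> finL x Lx /=; rewrite in_fset_set// mem_set. Qed.

Lemma Delta_net_filter (L : set R) : finite_set L -> Filter (Delta_net L).
Proof.
move=> finL; apply: filter_from_filter.
  by exists (fset_set L); exact: Delta_fset_set.
move=> X Y LX LY; exists (X `|` Y)%fset.
  by move=> x /LX /= xX; rewrite inE xX.
by move=> Z /=; rewrite fsubUset => /andP.
Qed.

(** When [l] is infinite no real lies above it, and the lower bound alone forces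
    the values to be eventually equal to [l]. *)
Lemma cvg_from_above (T : Type) (F : set_system T) (FF : Filter F)
    (f : T -> \bar R) (l : \bar R) :
  (0 <= l)%E -> (\forall x \near F, (l <= f x)%E) ->
  (forall c : R, (l < c%:E)%E -> \forall x \near F, (f x <= c%:E)%E) ->
  f x @[x --> F] --> l.
Proof.
case: l => [r| |] //= l0 lf fl.
  have lt_r (d : R) : 0 < d -> (r%:E < (r + d)%:E)%E by rewrite lte_fin ltrDl.
  apply/fine_cvgP; split.
    near=> x; rewrite fin_numElt; apply/andP; split.
      by apply: (@lt_le_trans _ _ r%:E); [exact: ltNyr|near: x].
    apply: (@le_lt_trans _ _ (r + 1)%:E); last exact: ltry.
    by near: x; apply/fl/lt_r.
  apply/cvgrPdist_le => d d0; near=> x => /=.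
  have : (r%:E <= f x)%E by near: x.
  have : (f x <= (r + d)%:E)%E by near: x; apply/fl/lt_r.
  case: (f x) => [y| |] //=; rewrite !lee_fin => yd ry.
  by rewrite distrC ger0_norm; lra.
apply: cvg_near_cst; apply: filterS lf => x.
by rewrite leye_eq => /eqP.
Unshelve. all: by end_near. Qed.

End Limit.

Lemma interleaving_dist_ge0 (K : fieldType) (R : realType) (F G : pmodule K R) :
  (0 <= interleaving_dist F G)%E.
Proof.
by apply: le_ereal_inf_tmp => _ [e [e_ge0 _] <-]; rewrite lee_fin.
Qed.

Theorem theorem2 (K : fieldType) (R : realType) (T : metricType R)
    (m : nat) (D : 'I_m -> {fset T}) (b : R) (b_gt0 : 0 < b)
    (I M : pmodule K R)
    (hI : endpoints_in (all_jumps D) I) (hM : endpoints_in (all_jumps D) M) :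
  discrete_dist b (pm_restrict X I) (pm_restrict X M)
    @[X --> Delta_net (all_jumps D)] --> interleaving_dist I M.
Proof.
have finL := all_jumps_finite D.
have IL := endpoints_in_piecewise_constant hI.
have ML := endpoints_in_piecewise_constant hM.
have FF := Delta_net_filter finL.
apply: cvg_from_above.
- exact: interleaving_dist_ge0.
- exists (fset_set (all_jumps D)); first exact: Delta_fset_set.
  move=> X /= /fsubsetP LX.
  have subX : all_jumps D `<=` [set` X].
    by move=> x Lx; apply/LX/Delta_fset_set.
  by apply: interleaving_dist_le_discrete => //; exact: piecewise_constant_sub subX _.
- move=> c /ereal_inf_lt[_ [e [e_ge0 IM] <-]]; rewrite lte_fin => ec.
  have ce0 : 0 < c - e by rewrite subr_gt0.
  have [X0 LX0 X0P] := discrete_dist_le_interleaving finL ce0.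
  exists X0 => // X /= X0X.
  by have := X0P X X0X K I M b e e_ge0 IL ML IM; rewrite subrKC.
Qed.
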